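(* Let $\mathcal{G}(\pi)$ be a colored directed graph with vertex set $V$, let $V_L\subseteq V$ be a leader set, and let $o$ be an elementary edge operation. Let $\mathcal{G}'(\pi')=\mathcal{G}(\pi,V_L,o)$ be a derived colored graph of $\mathcal{G}(\pi)$ with respect to $V_L$ and $o$. Then $(\mathcal{G}(\pi);V_L)$ is controllable if and only if $(\mathcal{G}'(\pi');V_L)$ is controllable.
   Context: Directed graphs $\mathcal{G}=(V,E)$ are simple: $V=\{1,\dots,n\}$, $E\subseteq V\times V$, and $E$ contains no edge $(i,i)$. A colored directed graph $\mathcal{G}(\pi)=(V,E,\pi)$ is a directed graph with a partition $\pi=\{E_1,\dots,E_k\}$ of $E$; edges in $E_r$ are said to have color $c_r$, and $\{c_1,\dots,c_k\}$ is the color set. Controllability. The qualitative class is $\mathcal{Q}(\mathcal{G})=\{A\in\mathbb{R}^{n\times n}\mid \text{for } i\neq j:\ A_{ij}\neq 0 \text{ iff } (j,i)\in E\}$ (diagonal entries are arbitrary reals), and the colored qualitative class is $\mathcal{Q}_\pi(\mathcal{G})=\{A\in\mathcal{Q}(\mathcal{G})\mid A_{ij}=A_{kl}\text{ if }(j,i),(l,k)\in E_r\text{ for some }r\}$. For a leader set $V_L=\{v_1,\dots,v_m\}\subseteq V$, let $B=B(V;V_L)\in\mathbb{R}^{n\times m}$ with $B_{ij}=1$ if $i=v_j$ and $B_{ij}=0$ otherwise. $(\mathcal{G}(\pi);V_L)$ is called controllable if the pair $(A,B)$ is controllable (in the classical sense for $\dot x=Ax+Bu$) for all $A\in\mathcal{Q}_\pi(\mathcal{G})$.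 Elementary edge operations. Let $C\subseteq V$ be a coloring set (the set of black vertices; vertices in $V\setminus C$ are white). For $u\in C$ let $N_{V\setminus C}(u)=\{j\in V\setminus C\mid (u,j)\in E\}$, and for $u,v\in C$ (possibly equal) let $\mathcal{E}_u(v)=\{(v,j)\in E\mid j\in N_{V\setminus C}(u)\}$. The two elementary edge operations (with respect to $C$) are: (1) Turn color: for $u\in C$ such that all edges in $\mathcal{E}_u(u)$ have the same color, change the color of these edges to any other color in the color set. (2) Remove edges: for distinct $u,v\in C$ such that $N_{V\setminus C}(u)\subseteq N_{V\setminus C}(v)$ and such that for every $k\in N_{V\setminus C}(u)$ the edges $(u,k)$ and $(v,k)$ have the same color, remove all edges in $\mathcal{E}_u(v)$. The colored graph $\mathcal{G}'(\pi')=(V,E',\pi')$ resulting from applying an operation $o$ to $\mathcal{G}(\pi)$ is called the derived graph of $\mathcal{G}(\pi)$ with respect to $C$ and $o$, denoted $\mathcal{G}(\pi,C,o)$. *)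

(* Defs.v *)
From HB Require Import structures.
From mathcomp Require Import all_boot all_order all_algebra.
From mathcomp Require Import all_classical all_reals all_analysis.
Import numFieldNormedType.Exports.
Import Order.TTheory GRing.Theory Num.Theory.

Set Implicit Arguments.
Unset Strict Implicit.
Unset Printing Implicit Defensive.

Local Open Scope ring_scope.

(* An edge (i, j) goes from i to j.  [cell r] is the set of edges of color r;
   the color set is all of 'I_k, and a color may be unused, so that it stays
   available after its last edge has been recolored or removed. *)
Record colored_digraph (n k : nat) := ColoredDigraph {
  edges : {set 'I_n * 'I_n};
  cell : 'I_k -> {set 'I_n * 'I_n};
  edges_irrefl : forall i : 'I_n, (i, i) \notin edges;
  cell_cover : edges = (\bigcup_(r < k) cell r)%SET;
  cell_disjoint : forall r s : 'I_k, r != s -> [disjoint cell r & cell s]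
}.

(* Row i, column j of A corresponds to the edge (j, i). *)
Definition qualitative_class (R : realType) (n : nat)
    (E : {set 'I_n * 'I_n}) (A : 'M[R]_n) : Prop :=
  forall i j : 'I_n, i != j -> (A i j != 0 <-> (j, i) \in E).

Definition colored_qualitative_class (R : realType) (n k : nat)
    (G : colored_digraph n k) (A : 'M[R]_n) : Prop :=
  qualitative_class (edges G) A /\
  forall (r : 'I_k) (i j p q : 'I_n),
    (j, i) \in cell G r -> (q, p) \in cell G r -> A i j = A p q.

(* The leaders v_1, ..., v_m are listed by the canonical enumeration of VL. *)
Definition leader_matrix (R : realType) (n : nat) (VL : {set 'I_n}) :
    'M[R]_(n, #|VL|) :=
  \matrix_(i, j) (i == enum_val j)%:R.

(* x solves x' = A x + B u on [0, T]; derivatives and continuity are taken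
   componentwise, with x continuous up to the end points. *)
Definition is_trajectory (R : realType) (n m : nat)
    (A : 'M[R]_n) (B : 'M[R]_(n, m)) (T : R)
    (u : R -> 'cV[R]_m) (x : R -> 'cV[R]_n) : Prop :=
  [/\ forall j : 'I_m, {within `[0, T], continuous (fun t : R => u t j 0)}%classic,
      forall i : 'I_n, {within `[0, T], continuous (fun t : R => x t i 0)}%classic
    & forall (t : R) (i : 'I_n), 0 < t < T ->
        is_derive t (1 : R) (fun s : R => x s i 0) ((A *m x t + B *m u t) i 0)].

(* Any state can be steered to any other state in finite time.  For
   time-invariant systems, continuous inputs steer between the same states as
   piecewise continuous or integrable ones. *)
Definition controllable_pair (R : realType) (n m : nat)
    (A : 'M[R]_n) (B : 'M[R]_(n, m)) : Prop :=
  forall x0 x1 : 'cV[R]_n,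
    exists (T : R) (u : R -> 'cV[R]_m) (x : R -> 'cV[R]_n),
      [/\ 0 < T, is_trajectory A B T u x, x 0 = x0 & x T = x1].

Definition controllable (R : realType) (n k : nat)
    (G : colored_digraph n k) (VL : {set 'I_n}) : Prop :=
  forall A : 'M[R]_n,
    colored_qualitative_class G A -> controllable_pair A (leader_matrix R VL).

Section EdgeOperations.
Variables (n k : nat).
Implicit Types (G : colored_digraph n k) (C : {set 'I_n}).

Definition white_nbrs G C (u : 'I_n) : {set 'I_n} :=
  [set j | (j \notin C) && ((u, j) \in edges G)].

(* E_u(v): the tail is v, while u only selects the heads. *)
Definition edges_toward G C (u v : 'I_n) : {set 'I_n * 'I_n} :=
  [set e in edges G | (e.1 == v) && (e.2 \in white_nbrs G C u)].

(* [TurnColor u s] gives color s to E_u(u); [RemoveEdges u v] removes E_u(v). *)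
Inductive edge_operation :=
  | TurnColor of 'I_n & 'I_k
  | RemoveEdges of 'I_n & 'I_n.

Definition elementary G C (o : edge_operation) : Prop :=
  match o with
  | TurnColor u s =>
      u \in C /\
      exists2 r : 'I_k, edges_toward G C u u \subset cell G r & s != r
  | RemoveEdges u v =>
      [/\ u \in C, v \in C, u != v,
          white_nbrs G C u \subset white_nbrs G C v
        & forall j : 'I_n, j \in white_nbrs G C u ->
            exists2 r : 'I_k, (u, j) \in cell G r & (v, j) \in cell G r]
  end.

Definition derived_edges G C (o : edge_operation) : {set 'I_n * 'I_n} :=
  match o with
  | TurnColor _ _ => edges G
  | RemoveEdges u v => edges G :\: edges_toward G C u v
  end.

Definition derived_cell G C (o : edge_operation) (r : 'I_k) :
    {set 'I_n * 'I_n} :=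
  match o with
  | TurnColor u s =>
      if r == s then cell G r :|: edges_toward G C u u
      else cell G r :\: edges_toward G C u u
  | RemoveEdges u v => cell G r :\: edges_toward G C u v
  end.

Lemma edges_toward_sub G C u v : edges_toward G C u v \subset edges G.
Proof. by apply/fintype.subsetP => e; rewrite inE => /andP[]. Qed.

Lemma derived_edges_irrefl G C o (i : 'I_n) : (i, i) \notin derived_edges G C o.
Proof.
case: o => [u s|u v] /=; first exact: edges_irrefl.
by rewrite inE negb_and edges_irrefl orbT.
Qed.

Lemma derived_cell_cover G C o :
  derived_edges G C o = (\bigcup_(r < k) derived_cell G C o r)%SET.
Proof.
apply/finset.setP => e; case: o => [u s|u v] /=; apply/idP/finset.bigcupP.
- move=> eE; case: (boolP (e \in edges_toward G C u u)) => eD.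
    by exists s => //; rewrite eqxx inE eD orbT.
  move: eE; rewrite cell_cover => /finset.bigcupP[r _ er]; exists r => //.
  by case: ifP => _; rewrite inE ?er ?eD.
- case=> r _; case: ifP => _; rewrite inE.
    case/orP => [er|]; last exact: fintype.subsetP (edges_toward_sub _ _ _ _) _.
    by rewrite cell_cover; apply/finset.bigcupP; exists r.
  by case/andP => _ er; rewrite cell_cover; apply/finset.bigcupP; exists r.
- rewrite inE => /andP[eD]; rewrite cell_cover => /finset.bigcupP[r _ er].
  by exists r => //; rewrite inE eD.
- case=> r _; rewrite !inE => /andP[-> er]; rewrite cell_cover.
  by apply/finset.bigcupP; exists r.
Qed.

Lemma derived_cell_disjoint G C o (r s : 'I_k) :
  r != s -> [disjoint derived_cell G C o r & derived_cell G C o s].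
Proof.
move=> rs; have /pred0P dis := cell_disjoint G rs.
apply/pred0P => e /=; move: (dis e) => /=.
case: o => [u t|u v] /=; last first.
  by rewrite !inE; do 2!case: (e \in cell G _) => //=; rewrite ?andbF.
case: (eqVneq r t) => [rt|_]; case: (eqVneq s t) => [st|_];
  first by rewrite rt st eqxx in rs.
all: rewrite ?finset.in_setU ?finset.in_setD; move: (e \in edges_toward G C u u).
all: by move: (e \in cell G r) (e \in cell G s) => [] [] [].
Qed.

Definition derived_graph G C (o : edge_operation) : colored_digraph n k :=
  ColoredDigraph (@derived_edges_irrefl G C o) (derived_cell_cover G C o)
    (@derived_cell_disjoint G C o).

End EdgeOperations.

(* Main.v *)
Require Import Defs.
From mathcomp Require Import all_boot all_order all_algebra.
From mathcomp Require Import all_classical all_reals all_analysis.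
From mathcomp Require Import ring.

(** The inputs act directly on the leader coordinates, so whatever the leader
    rows of [A] prescribe can be cancelled by feedback: only the white rows (the
    rows outside [VL]) of [A] matter, and they matter only up to a linear change
    of coordinates that leaves the white coordinates alone.  This is feedback
    equivalence, and it is proved directly on trajectories in
    [controllable_pair_feedback], without the rank criterion.  Applied to a
    change of coordinates by an elementary matrix, it gives
    [controllable_pair_column_op]: adding, in the white rows, a multiple of a
    leader's column to a column does not affect controllability.

    Both edge operations are such column operations.  If all edges of [E_u(u)]
    have color [r], then in the white rows column [u] is supported on [E_u(u)]
    with constant value [w r], and recoloring to [s] multiplies it by
    [w s / w r].  If the edges [(u, j)] and [(v, j)] have equal colors for all
    white out-neighbors [j] of [u], then subtracting column [u] from column [v]
    in the white rows erases exactly the entries of [E_u(v)].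

    To compare the two colored classes, each is parametrized by one nonzero
    weight per color and an arbitrary diagonal ([weighted_mx]).  The parameters
    are the same before and after the operation, so it suffices to compare the
    two matrices with equal parameters ([controllable_pair_derived]); both
    directions of the theorem follow at once. *)

Import numFieldNormedType.Exports.
Import Order.TTheory GRing.Theory Num.Theory.

Set Implicit Arguments.
Unset Strict Implicit.
Unset Printing Implicit Defensive.

Local Open Scope ring_scope.

(** * Feedback equivalence of controlled linear systems *)

Lemma within_continuous_mulmx (R : realType) (p q : nat) (D : set R)
    (M : 'M[R]_(p, q)) (x : R -> 'cV[R]_q) :
    (forall j, {within D, continuous (fun t => x t j 0)}%classic) ->
  forall i, {within D, continuous (fun t => (M *m x t) i 0)}%classic.
Proof.
move=> cx i.
have -> : (fun t => (M *m x t) i 0) = fun t => \sum_j M i j * x t j 0.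
  by apply/funext => t; rewrite mxE.
move=> t; apply: cvg_big => //=.
  by apply: add_continuous.
by move=> j _; apply: cvgM; [exact: cvg_cst|exact: cx].
Qed.

Lemma is_derive_mulmx (R : realType) (p q : nat) (M : 'M[R]_(p, q))
    (x : R -> 'cV[R]_q) (dx : 'cV[R]_q) (t : R) :
    (forall j, is_derive t (1 : R) (fun s => x s j 0) (dx j 0)) ->
  forall i, is_derive t (1 : R) (fun s => (M *m x s) i 0) ((M *m dx) i 0).
Proof.
move=> dxE i.
have -> : (fun s => (M *m x s) i 0) = \sum_j (M i j *: fun s => x s j 0).
  by apply/funext => s; rewrite mxE fct_sumE.
by rewrite mxE; apply: is_derive_sum.
Qed.

(** If [x] solves [x' = A x + B u], then [z = M x] solves
    [z' = M A x + M B u = A' z + B (F x + N u)], so [F x + N u] is an input for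
    [A'] that steers [M x0] to [M x1]; since [M] is invertible, these are
    arbitrary states. *)
Lemma controllable_pair_feedback (R : realType) (n m : nat)
    (A A' M : 'M[R]_n) (B : 'M[R]_(n, m)) (F : 'M[R]_(m, n)) (N : 'M[R]_m) :
    M \in unitmx -> M *m A = A' *m M + B *m F -> M *m B = B *m N ->
  controllable_pair A B -> controllable_pair A' B.
Proof.
move=> Mu MA MB ctrl z0 z1.
have [T [u [x [T0 [cu cx dx] x0 x1]]]] := ctrl (invmx M *m z0) (invmx M *m z1).
exists T, (fun t => F *m x t + N *m u t), (fun t => M *m x t).
split=> //; last 2 first.
- by rewrite x0 mulKVmx.
- by rewrite x1 mulKVmx.
split.
- move=> j.
  have -> : (fun t => (F *m x t + N *m u t) j 0) =
            fun t => (F *m x t) j 0 + (N *m u t) j 0.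
    by apply/funext => t; rewrite mxE.
  by move=> t; apply: cvgD; apply: within_continuous_mulmx.
- exact: within_continuous_mulmx.
- move=> t i tT.
  have -> : A' *m (M *m x t) + B *m (F *m x t + N *m u t) =
            M *m (A *m x t + B *m u t).
    by rewrite !mulmxDr !mulmxA MA MB mulmxDl addrA.
  by apply: is_derive_mulmx => j; exact: dx.
Qed.

(** * Changes of coordinates that fix the non-leaders *)

(** [B *m B^T] is the projector on the leader coordinates, so every map into
    these coordinates can be produced by the inputs. *)
Lemma leader_matrix_factor (R : realType) (n p : nat) (VL : {set 'I_n})
    (X : 'M[R]_(n, p)) :
    (forall i, i \notin VL -> row i X = 0) ->
  X = leader_matrix R VL *m ((leader_matrix R VL)^T *m X).
Proof.
move=> X0; apply/matrixP => i j; rewrite mxE.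
case: (boolP (i \in VL)) => iVL; last first.
  have /rowP/(_ j) := X0 i iVL; rewrite !mxE => ->.
  rewrite big1 // => l _; rewrite !mxE; case: eqP => [il|]; last by rewrite mul0r.
  by move: iVL; rewrite il enum_valP.
have valK := enum_rankK_in iVL iVL; set l := enum_rank_in iVL i in valK *.
rewrite (bigD1 l) //= big1 ?addr0 => [|l' l'l].
  rewrite !mxE valK eqxx mul1r (bigD1 i) //= big1 ?addr0 => [|q qi].
    by rewrite !mxE valK eqxx mul1r.
  by rewrite !mxE valK (negbTE qi) mul0r.
by rewrite mxE -[in i == _]valK (inj_eq enum_val_inj) eq_sym (negbTE l'l) mul0r.
Qed.

Lemma row_leader_matrix (R : realType) (n : nat) (VL : {set 'I_n}) i :
  i \notin VL -> row i (leader_matrix R VL) = 0.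
Proof.
move=> iVL; apply/rowP => j; rewrite !mxE; case: eqP => // ij.
by move: iVL; rewrite ij enum_valP.
Qed.

(** Since the white rows of [M] are those of the identity, [M *m A] has the white
    rows of [A].  Hence [M *m A - A' *m M] and [M *m B] live in the leader rows,
    where the inputs can absorb them. *)
Lemma controllable_pair_leader (R : realType) (n : nat) (VL : {set 'I_n})
    (A A' M : 'M[R]_n) :
    M \in unitmx ->
    (forall i, i \notin VL -> row i M = row i 1%:M) ->
    (forall i, i \notin VL -> row i A = row i (A' *m M)) ->
  controllable_pair A (leader_matrix R VL) ->
  controllable_pair A' (leader_matrix R VL).
Proof.
move=> Mu Mrow Arow; set B := leader_matrix R VL.
apply: (controllable_pair_feedback (M := M) (F := B^T *m (M *m A - A' *m M))
          (N := B^T *m (M *m B))) => //.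
- rewrite -leader_matrix_factor ?subrKC // => i iVL.
  by rewrite raddfB /= row_mul Mrow // -row_mul mul1mx Arow // subrr.
- apply: leader_matrix_factor => i iVL.
  by rewrite row_mul Mrow // -row_mul mul1mx row_leader_matrix.
Qed.

(** The matrices [M] whose white rows are those of the identity form a group, so
    the previous lemma also applies with [invmx M], and [A] and [A'] exchanged. *)
Lemma controllable_pair_leader_iff (R : realType) (n : nat) (VL : {set 'I_n})
    (A A' M : 'M[R]_n) :
    M \in unitmx ->
    (forall i, i \notin VL -> row i M = row i 1%:M) ->
    (forall i, i \notin VL -> row i A' = row i (A *m M)) ->
  controllable_pair A (leader_matrix R VL) <->
  controllable_pair A' (leader_matrix R VL).
Proof.
move=> Mu Mrow Arow; split; last exact: controllable_pair_leader Mu Mrow Arow.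
apply: (controllable_pair_leader (M := invmx M)); first by rewrite unitmx_inv.
- by move=> i iVL; rewrite -[invmx M]mul1mx row_mul -{1}Mrow // -row_mul mulmxV.
- by move=> i iVL; rewrite row_mul Arow // -row_mul mulmxK.
Qed.

(** The case [u = v] is a scaling of one coordinate, the case [u != v] a
    transvection; they are the changes of coordinates behind recoloring and
    edge removal respectively. *)
Lemma elementary_mx_unit (F : fieldType) (n : nat) (u v : 'I_n) (c : F) :
  1 + c *+ (u == v) != 0 -> 1%:M + c *: delta_mx u v \in unitmx.
Proof.
(* The square of delta_mx u v is itself if u = v and zero otherwise, so the
   inverse is 1 + c' delta_mx u v with c + c' + c c' [u = v] = 0. *)
move=> c1; set c' := - c / (1 + c *+ (u == v)).
suff /mulmx1_unit[] : (1%:M + c *: delta_mx u v) *m (1%:M + c' *: delta_mx u v) =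
   1%:M by [].
rewrite mulmxDl mul1mx mulmxDr mulmx1 -scalemxAl -scalemxAr mul_delta_mx_cond.
rewrite -addrA -[RHS]addr0; congr (_ + _).
rewrite -!scalerMnr scalerA scalerMnl -!scalerDl.
rewrite (_ : c' + _ = 0) ?scale0r // /c' (eq_sym v u).
by move: c1; case: (u == v); rewrite ?mulr1n ?mulr0n ?addr0 => c1; field.
Qed.

(** Right multiplication by [1 + c *: delta_mx u v] adds [c] times column [u] to
    column [v].  As a change of coordinates it alters coordinate [u] only, and
    that is admissible because [u] is a leader. *)
Lemma controllable_pair_column_op (R : realType) (n : nat) (VL : {set 'I_n})
    (A A' : 'M[R]_n) (u v : 'I_n) (c : R) :
    u \in VL -> 1 + c *+ (u == v) != 0 ->
    (forall i j, i \notin VL -> A' i j = A i j + (c * A i u) *+ (j == v)) ->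
  controllable_pair A (leader_matrix R VL) <->
  controllable_pair A' (leader_matrix R VL).
Proof.
move=> uVL c1 A'E.
apply: (controllable_pair_leader_iff (elementary_mx_unit c1)) => i iVL.
  apply/rowP => j; rewrite !mxE (_ : i == u = false) ?mulr0 ?addr0 //.
  by apply/negbTE; apply: contraNneq iVL => ->.
apply/rowP => j; rewrite mxE A'E // mxE mulmxDr mulmx1 -scalemxAr !mxE.
congr (_ + _); rewrite (bigD1 u) //= big1 ?addr0 => [|q qu].
  by rewrite mxE eqxx mulr_natr mulrnAr.
by rewrite mxE (negbTE qu) mulr0.
Qed.

(** * Parametrization of the colored class by color weights *)

Section WeightedMatrix.
Variables (R : realType) (n k : nat).
Implicit Types (G : colored_digraph n k) (w : 'I_k -> R) (d : 'I_n -> R).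

Lemma cell_sub_edges G r e : e \in cell G r -> e \in edges G.
Proof. by rewrite cell_cover => er; apply/finset.bigcupP; exists r. Qed.

Lemma edge_cell G e : e \in edges G -> exists r, e \in cell G r.
Proof. by rewrite cell_cover => /finset.bigcupP[r _ er]; exists r. Qed.

Lemma cell_inj G r s e : e \in cell G r -> e \in cell G s -> r = s.
Proof.
move=> er es; apply/eqP; apply: contraT => /(cell_disjoint G) /pred0P /(_ e) /=.
by rewrite er es.
Qed.

Lemma edge_neq G i j : (j, i) \in edges G -> i != j.
Proof. by apply: contraTneq => ->; exact: edges_irrefl. Qed.

(** As the cells are disjoint and contain no loop, at most one summand is present,
    so the entry of an edge is the weight of its color.  The formula refers to the
    cells only, which makes matrices of different graphs easy to compare. *)
Definition weighted_mx G w d : 'M[R]_n :=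
  \matrix_(i, j) (d i *+ (i == j) + \sum_(r | (j, i) \in cell G r) w r).

Lemma weighted_mx_cell G w d r i j :
  (j, i) \in cell G r -> weighted_mx G w d i j = w r.
Proof.
move=> er; rewrite mxE (negbTE (edge_neq (cell_sub_edges er))) add0r.
rewrite (bigD1 r) //= big1 ?addr0 // => s /andP[es].
by rewrite (cell_inj es er) eqxx.
Qed.

Lemma weighted_mx_nonedge G w d i j :
  i != j -> (j, i) \notin edges G -> weighted_mx G w d i j = 0.
Proof.
move=> /negbTE ij ne; rewrite mxE ij add0r big1 // => r /cell_sub_edges.
by rewrite (negbTE ne).
Qed.

Lemma eq_weighted_mx G G' w d i j :
    (forall r, ((j, i) \in cell G r) = ((j, i) \in cell G' r)) ->
  weighted_mx G w d i j = weighted_mx G' w d i j.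
Proof. by move=> eqc; rewrite !mxE (eq_bigl _ _ eqc). Qed.

Lemma weighted_mx_class G w d :
  (forall r, w r != 0) -> colored_qualitative_class G (weighted_mx G w d).
Proof.
move=> w0; split=> [i j ij|r i j p q ji qp]; last first.
  by rewrite !(weighted_mx_cell _ _ (r := r)).
split=> [|/edge_cell[r er]]; last by rewrite (weighted_mx_cell _ _ er).
by apply: contraNT => ne; rewrite weighted_mx_nonedge.
Qed.

(** The weight of a color is the entry of any edge of that color; a color without
    edges leaves its weight free, and 1 serves as a nonzero default. *)
Lemma colored_qualitative_class_weighted G (A : 'M[R]_n) :
    colored_qualitative_class G A ->
  exists w d, (forall r, w r != 0) /\ A = weighted_mx G w d.
Proof.
move=> [qA cA].
pose w r := if [pick e in cell G r] is Some e then A e.2 e.1 else 1.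
exists w, (fun i => A i i); split=> [r|].
  rewrite /w; case: pickP => [[j i] /cell_sub_edges e|_]; last exact: oner_neq0.
  by apply/(qA i j (edge_neq e)).
apply/matrixP => i j; have [<-|ij] := eqVneq i j.
  rewrite mxE eqxx big1 ?addr0 // => r /cell_sub_edges.
  by rewrite (negbTE (edges_irrefl G i)).
have [/edge_cell[r er]|ne] := boolP ((j, i) \in edges G).
  rewrite (weighted_mx_cell _ _ er) /w.
  by case: pickP => [[q p] /(cA _ _ _ _ _ er)//|/(_ (j, i))]; rewrite er.
rewrite weighted_mx_nonedge //; apply/eqP; apply: contraNT ne.
by move/(qA i j ij).
Qed.

(** Weights range over all colors, including those without edges.  This lets one
    choice of weights serve for a graph and for its derived graph, even when an
    operation uses up the last edge of a color or brings a color into use. *)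
Lemma controllable_weighted G VL :
  controllable R G VL <->
  forall w d, (forall r, w r != 0) ->
    controllable_pair (weighted_mx G w d) (leader_matrix R VL).
Proof.
split=> [ctrl w d w0|ctrl A /colored_qualitative_class_weighted[w [d [w0 ->]]]].
  exact/ctrl/weighted_mx_class.
exact: ctrl.
Qed.

(** * Edge operations as column operations *)

Lemma mem_edges_toward G C u v i j :
  ((j, i) \in edges_toward G C u v) =
  [&& j == v, (v, i) \in edges G, i \notin C & (u, i) \in edges G].
Proof. by rewrite !inE /=; case: eqP => [->|_] //=; rewrite andbF. Qed.

Definition altered_edges G C (o : edge_operation n k) : {set 'I_n * 'I_n} :=
  match o with
  | TurnColor u _ => edges_toward G C u u
  | RemoveEdges u v => edges_toward G C u v
  end.

Lemma weighted_mx_derived_unaltered G C o w d i j :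
    (j, i) \notin altered_edges G C o ->
  weighted_mx (derived_graph G C o) w d i j = weighted_mx G w d i j.
Proof.
move=> ji; apply: eq_weighted_mx => r; case: o ji => [u s|u v] /= /negbTE ji.
  by case: ifP => _; rewrite ?finset.in_setU ?finset.in_setD ji ?orbF.
by rewrite finset.in_setD ji.
Qed.

(** Recoloring multiplies column [u] by [w s / w r] in the white rows, that is,
    adds [w s / w r - 1] times column [u] to itself; edge removal subtracts
    column [u] from column [v].  The diagonal entries of the white rows lie in
    columns of non-leaders, which neither operation touches. *)
Lemma controllable_pair_derived G VL o w d :
    elementary G VL o -> (forall r, w r != 0) ->
  controllable_pair (weighted_mx G w d) (leader_matrix R VL) <->
  controllable_pair (weighted_mx (derived_graph G VL o) w d)
    (leader_matrix R VL).
Proof.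
have neqVL (i u : 'I_n) : u \in VL -> i \notin VL -> i != u.
  by move=> uVL; apply: contraNneq => ->.
case: o => [u s [uVL [r /fintype.subsetP Er _]]|u v [uVL vVL uv _ same]] w0.
- apply: (controllable_pair_column_op (u := u) (v := u) (c := w s / w r - 1)) => //.
    by rewrite eqxx subrKC mulf_neq0 ?invr_neq0.
  move=> i j iVL; have [ji|ji] := boolP ((j, i) \in edges_toward G VL u u).
    have jis : (j, i) \in cell (derived_graph G VL (TurnColor u s)) s.
      by rewrite /= eqxx finset.in_setU ji orbT.
    have jir := Er _ ji.
    have /eqP ju : j == u by move: ji; rewrite mem_edges_toward => /and4P[].
    subst j; rewrite (weighted_mx_cell _ _ jis) (weighted_mx_cell _ _ jir) eqxx.
    by rewrite mulr1n mulrBl mul1r divfK // subrKC.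
  (* Off E_u(u), a white entry of column u vanishes, so scaling keeps it. *)
  rewrite weighted_mx_derived_unaltered //; case: eqP => [ju|]; last by rewrite addr0.
  move: ji; rewrite ju mem_edges_toward eqxx iVL /= andbb => ui.
  by rewrite (weighted_mx_nonedge _ _ (neqVL _ _ uVL iVL) ui) mulr0 addr0.
- apply: (controllable_pair_column_op (u := u) (v := v) (c := -1)) => //.
    by rewrite (negbTE uv) addr0 oner_neq0.
  move=> i j iVL; have [ji|ji] := boolP ((j, i) \in edges_toward G VL u v).
    move: (ji); rewrite mem_edges_toward => /and4P[/eqP jv _ _ ui]; subst j.
    have [|r uir vir] := same i; first by rewrite inE iVL.
    rewrite (weighted_mx_cell _ _ uir) (weighted_mx_cell _ _ vir) eqxx mulN1r subrr.
    rewrite weighted_mx_nonedge ?(neqVL _ _ vVL iVL) //=.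
    by rewrite finset.in_setD ji.
  (* A white head of an edge of u is the head of an edge of v, which E_u(v)
     contains; so here column u has a zero entry. *)
  rewrite weighted_mx_derived_unaltered //; case: eqP => [jv|]; last by rewrite addr0.
  have ui : (u, i) \notin edges G.
    apply: contraNN ji => ui; have [|r _ vir] := same i; first by rewrite inE iVL.
    by rewrite jv mem_edges_toward eqxx (cell_sub_edges vir) iVL.
  by rewrite (weighted_mx_nonedge _ _ (neqVL _ _ uVL iVL) ui) mulr0 addr0.
Qed.

End WeightedMatrix.

Theorem theorem19 (R : realType) (n k : nat) (G : colored_digraph n k)
    (VL : {set 'I_n}) (o : edge_operation n k)
    (elem_o : elementary G VL o) :
  controllable R G VL <-> controllable R (derived_graph G VL o) VL.
Proof.
split=> /controllable_weighted ctrl; apply/controllable_weighted => w d w0.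
  by apply/(controllable_pair_derived d elem_o w0)/ctrl.
by apply/(controllable_pair_derived d elem_o w0)/ctrl.
Qed.
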